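(* Let $\tau$ be the coupling time of the chain $X$ defined on $\mathcal{N}$ corresponding to the ATO-POS system with joint services. Assume $\mu>\sum_{i}\lambda_i$. Then $$\mathbb{E}[\tau]\le\frac{\Lambda}{\mu-\sum_i\lambda_i}|C| .$$
   Context: Let $I\ge1$, $\mathcal{I}=\{1,\dots,I\}$, $C=(C_1,\dots,C_I)$ a vector of positive integers, $|C|=\sum_iC_i$, $\mu>0$, $\lambda_A\ge0$ for each nonempty $A\subset\mathcal{I}$, $\lambda=\sum_A\lambda_A$, $\lambda_i=\sum_{A\ni i}\lambda_A$, and $\Lambda=\lambda+\mu|C|$. State space: $\mathcal{N}=\{(n_A)_{\emptyset\ne A\subseteq\mathcal{I}}: n_A\in\mathbb{Z}_{\ge0}\ \forall A,\ \sum_{A\ni i}n_A\le C_i\ \forall i\in\mathcal{I}\}$; for nonempty $A$, $e_A$ is the vector with coordinate $A$ equal to $1$ and the others $0$, and $e_\emptyset=0$. For $n\in\mathcal{N}$, $\psi(n)=(\sum_{A\ni i}n_A)_{i\in\mathcal{I}}$. Ordering of subsets: for $i\in\mathcal{I}$ and $0\le k\le2^{I-i}-1$ with binary representation $k=\sum_{s=1}^{I-i}k_s2^{I-i-s}$, $k_s\in\{0,1\}$, let $A^i_k\subset\{i,\dots,I\}$ be the set with $i\in A^i_k$ and, for $s\in\{i+1,\dots,I\}$, $s\in A^i_k$ iff $k_{s-i}=0$. Events $\mathcal{E}$ and transition function $g:\mathcal{N}\times\mathcal{E}\to\mathcal{N}$: - arrivals $d_A$ ($\emptyset\ne A\subset\mathcal{I}$),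 of probability $\lambda_A/\Lambda$: $g(n,d_A)=n+e_{A^{(n)}}$ with $A^{(n)}=\{i\in A:(\psi(n))_i<C_i\}$; - services $r^i_j$ ($i\in\mathcal{I}$, $1\le j\le C_i$), each of probability $\mu/\Lambda$: if $\sum_{\ell=0}^{2^{I-i}-1}n_{A^i_\ell}<j$ then $g(n,r^i_j)=n$; otherwise $g(n,r^i_j)=n-e_{A^i_k}$, where $k$ is the minimal index with $\sum_{\ell=0}^{k-1}n_{A^i_\ell}<j\le\sum_{\ell=0}^{k}n_{A^i_\ell}$. $g$ is extended to words of events by applying the events successively from left to right, and to subsets $U\subset\mathcal{N}$ by $g(U,w)=\{g(n,w):n\in U\}$. Let $(a_{-t})_{t\in\mathbb{N}}=(a_0,a_{-1},\dots)$ be i.i.d. events with distribution $\nu$ on $\mathcal{E}$ given by $\nu(d_A)=\lambda_A/\Lambda$ for $\emptyset\ne A\subset\mathcal{I}$ and $\nu(r^i_j)=\mu/\Lambda$ for $i\in\mathcal{I}$, $1\le j\le C_i$, and $a_{-t+1\to0}=a_{-t+1}\cdots a_0$. The coupling time is $\tau=\min\{t:|g(\mathcal{N},a_{-t+1\to0})|=1\}$. *)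

(* Defs.v *)
(* MathComp / MathComp-Analysis *)
From HB Require Import structures.
From mathcomp Require Import all_boot all_order all_algebra.

Set Implicit Arguments.
Unset Strict Implicit.
Unset Printing Implicit Defensive.

(* Indices are shifted by one: the ordinal i : 'I_m stands for the element i+1
   of {1, ..., m}, and j : 'I_(C i) stands for the service index j+1. *)

Notation neset m := {A : {set 'I_m} | A != set0}.

Section System.
Variables (m : nat) (C : 'I_m -> nat).

Definition psi (n : {ffun neset m -> nat}) (i : 'I_m) : nat :=
  \sum_(A : neset m | i \in val A) n A.

Definition admissible (n : {ffun neset m -> nat}) : bool :=
  [forall i, psi n i <= C i].

Record state := State {
  counts :> {ffun neset m -> nat};
  counts_admissible : admissible counts }.

HB.instance Definition _ := [isSub for counts].
HB.instance Definition _ := [Countable of state by <:].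

Lemma counts_le_capacity (n : state) (A : neset m) : n A <= \sum_i C i.
Proof.
case: (set_0Vmem (val A)) => [A0 | [i iA]]; first by case/eqP: (valP A).
have /forallP/(_ i) := counts_admissible n.
rewrite /psi (bigD1 A) //= (bigD1 i) //= => h.
by rewrite (leq_trans _ (leq_addr _ _)) // (leq_trans _ h) ?leq_addr.
Qed.

Let encode (n : state) : {ffun neset m -> 'I_(\sum_i C i).+1} :=
  [ffun A => inord (n A)].
Let decode (f : {ffun neset m -> 'I_(\sum_i C i).+1}) : option state :=
  insub [ffun A => f A : nat].

Let encodeK : pcancel encode decode.
Proof.
move=> n; rewrite /decode.
have -> : [ffun A => encode n A : nat] = val n.
  by apply/ffunP => A; rewrite !ffunE inordK // ltnS counts_le_capacity.
by rewrite valK.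
Qed.

HB.instance Definition _ := isFinite.Build state (pcan_enumP encodeK).

(* The nat-valued analogue of e_A, which is 0 when A is empty. *)
Definition unit_vec (A : {set 'I_m}) : {ffun neset m -> nat} :=
  [ffun B => (val B == A : nat)].

Definition available (n : state) (A : {set 'I_m}) : {set 'I_m} :=
  [set i in A | psi n i < C i].

Fact arrive_admissible (n : state) (A : {set 'I_m}) :
  admissible [ffun B => n B + unit_vec (available n A) B].
Proof.
apply/forallP => i; rewrite /psi.
under eq_bigr do rewrite !ffunE.
rewrite big_split /=.
have [iA|niA] := boolP (i \in available n A).
  have nz : available n A != set0 by apply/set0Pn; exists i.
  have -> : \sum_(B : neset m | i \in val B) (val B == available n A : nat) = 1.
    rewrite (bigD1 (Sub (available n A) nz : neset m)) //= eqxx big1 // => B.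
    by case/andP => _; rewrite -val_eqE /= => /negbTE ->.
  by rewrite addn1; move: iA; rewrite inE => /andP[].
rewrite [X in _ + X]big1 ?addn0; first exact: (forallP (counts_admissible n)).
by move=> B iB; case: eqP => // eB; rewrite -eB iB in niA.
Qed.

Definition arrive (n : state) (A : {set 'I_m}) : state :=
  State (arrive_admissible n A).

Fact depart_admissible (n : state) (A : {set 'I_m}) :
  admissible [ffun B => n B - unit_vec A B].
Proof.
apply/forallP => i; apply: leq_trans (forallP (counts_admissible n) i).
by apply: leq_sum => B _; rewrite ffunE leq_subr.
Qed.

(* The subtraction is truncated, but [serve] only removes a unit from a
   positive coordinate. *)
Definition depart (n : state) (A : {set 'I_m}) : state :=
  State (depart_admissible n A).

(* The binary digit of weight 2^e of k. *)
Definition binary_digit (e k : nat) : bool := odd (k %/ 2 ^ e).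

(* For 1-based i < s, membership of s in A^i_k is decided by the digit k_(s-i),
   of weight 2^(m-s), that is 2^(m-s0-1) for the ordinal s0 = s-1. *)
Definition ordered_set (i : 'I_m) (k : nat) : {set 'I_m} :=
  [set s : 'I_m |
    (s == i) || ((i < s) && ~~ binary_digit (m - s.+1) k)].

Fact ordered_set_neq0 (i : 'I_m) (k : nat) : ordered_set i k != set0.
Proof. by apply/set0Pn; exists i; rewrite inE eqxx. Qed.

Definition ordered_neset (i : 'I_m) (k : nat) : neset m :=
  Sub (ordered_set i k) (ordered_set_neq0 i k).

Definition prefix_count (n : state) (i : 'I_m) (k : nat) : nat :=
  \sum_(l < k) n (ordered_neset i l).

(* The argument j is the 1-based service index.  When the test fails, the
   searched-for k exists among 0, ..., 2^(m-i)-1, and [find] on this increasing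
   enumeration returns the least one. *)
Definition serve (n : state) (i : 'I_m) (j : nat) : state :=
  let K := 2 ^ (m - i.+1) in
  if prefix_count n i K < j then n
  else
    let k := find (fun k => prefix_count n i k < j <= prefix_count n i k.+1)
                  (iota 0 K) in
    depart n (ordered_set i k).

Inductive event :=
  | Arrival of neset m
  | Service (i : 'I_m) of 'I_(C i).

Definition g (n : state) (a : event) : state :=
  match a with
  | Arrival A => arrive n (val A)
  | Service i j => serve n i j.+1
  end.

Definition g_word (n : state) (w : seq event) : state := foldl g n w.

Definition g_image (U : {set state}) (w : seq event) : {set state} :=
  [set g_word n w | n in U].

(* With a t standing for the event a_(-t), this is the word
   a_(-t+1) ... a_0, whose first letter is the oldest event. *)
Definition past_word (a : nat -> event) (t : nat) : seq event :=
  rev [seq a s | s <- iota 0 t].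

Definition coupled (a : nat -> event) (t : nat) : bool :=
  #|g_image [set: state] (past_word a t)| == 1.

End System.

From mathcomp Require Import all_classical all_reals all_analysis.

Import Order.TTheory GRing.Theory Num.Theory.

Local Open Scope classical_set_scope.
Local Open Scope ring_scope.

Section Rates.
Variables (R : realType) (m : nat) (C : 'I_m -> nat).
Variables (mu : R) (lam : neset m -> R).

Definition total_capacity : nat := (\sum_i C i)%N.

Definition total_lam : R := \sum_(A : neset m) lam A.

Definition lam_item (i : 'I_m) : R := \sum_(A : neset m | i \in val A) lam A.

Definition Lambda : R := total_lam + mu * total_capacity%:R.

Definition nu (a : event C) : R :=
  match a with
  | Arrival A => lam A / Lambda
  | Service _ _ => mu / Lambda
  end.

End Rates.

Section Probability.
Variables (R : realType) (d : measure_display) (T : measurableType d).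
Variable P : probability T R.

(* E is meant to be finite and carries the discrete sigma-algebra, so that the
   law of a variable is given by the masses of the points. *)
Definition iid_with_law (E : Type) (p : E -> R) (a : nat -> T -> E) : Prop :=
  [/\ forall t (B : set E), measurable (a t @^-1` B),
      forall t e, P (a t @^-1` [set e]) = (p e)%:E &
      forall (J : seq nat) (B : nat -> set E), uniq J ->
        P (\bigcap_(t in [set` J]) (a t @^-1` B t)) =
        (\prod_(t <- J) P (a t @^-1` B t))%E].

(* The infimum is a minimum as soon as coupling occurs, and +oo otherwise. *)
Definition coupling_time (m : nat) (C : 'I_m -> nat)
    (a : nat -> T -> event C) (w : T) : \bar R :=
  ereal_inf [set t%:R%:E | t in [set t : nat | coupled (a ^~ w) t]].

End Probability.

(* Main.v *)
(* For each item i let M_i(U) be the largest number of orders with least item i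
   over the states of U, and let D(U) be the sum of the M_i(U).  The services
   r^i_j only remove orders with least item i, and r^i_j removes one exactly
   from the states having at least j of them; so M_i decreases by one whenever
   j <= M_i(U), that is at rate mu M_i(U).  An arrival d_A increases M_i by at
   most one, and only if i is in A, so D(U) has drift at most
   (sum_i lambda_i - mu D(U)) / Lambda.  If D(U) = 0 the only state left is the
   empty one, hence the drift is at most -(mu - sum_i lambda_i) / Lambda as long
   as U is not a singleton.  As D <= |C|, summing the drift bounds
   sum_t P(not coupled at t), which dominates E[tau]. *)
From HB Require Import structures.
Require Import Defs.
From mathcomp Require Import all_boot all_order all_algebra.
From mathcomp Require Import zify ring.

Set Implicit Arguments.
Unset Strict Implicit.
Unset Printing Implicit Defensive.

(** * Binary digits and the enumeration of subsets by least item *)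

Section BinaryDigits.
Local Open Scope nat_scope.

Lemma binary_digit0 k : binary_digit 0 k = odd k.
Proof. by rewrite /binary_digit expn0 divn1. Qed.

Lemma binary_digitS e k : binary_digit e.+1 k = binary_digit e k./2.
Proof. by rewrite /binary_digit expnS divnMA divn2. Qed.

Lemma binary_digit_inj E k l : k < 2 ^ E -> l < 2 ^ E ->
  (forall e, e < E -> binary_digit e k = binary_digit e l) -> k = l.
Proof.
elim: E k l => [|E IH] k l; first by case: k l => [|[]] [|[]].
rewrite expnS mul2n -!ltn_half_double => kE lE eq_digits.
rewrite -[k]odd_double_half -[l]odd_double_half -!binary_digit0 eq_digits //.
by rewrite (IH _ _ kE lE) // => e eE; rewrite -!binary_digitS eq_digits.
Qed.

Lemma binary_digit_ex E (b : nat -> bool) :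
  exists2 k, k < 2 ^ E & forall e, e < E -> binary_digit e k = b e.
Proof.
elim: E b => [|E IH] b; first by exists 0.
have [k kE digits_k] := IH (fun e => b e.+1); exists (b 0 + k.*2).
  by rewrite expnS mul2n -ltn_half_double half_bit_double.
case=> [_|e eE]; first by rewrite binary_digit0 oddD odd_double addbF oddb.
by rewrite binary_digitS half_bit_double digits_k.
Qed.

Lemma ordered_set_inj m (i : 'I_m) k l :
  k < 2 ^ (m - i.+1) -> l < 2 ^ (m - i.+1) ->
  ordered_set i k = ordered_set i l -> k = l.
Proof.
move=> kK lK eq_kl; apply: (binary_digit_inj kK lK) => e eK.
(* The digit of weight [2 ^ e] governs the item [m - e.+1], which lies above [i] because
   [e < m - i.+1]. *)
have s_lt : m - e.+1 < m by lia.
have := congr1 (fun A : {set 'I_m} => Ordinal s_lt \in A) eq_kl.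
rewrite !inE -val_eqE /=.
have -> : (m - e.+1 == i) = false by lia.
have -> : (i < m - e.+1) = true by lia.
have -> : m - (m - e.+1).+1 = e by lia.
exact: negb_inj.
Qed.

(** Take [i] least in [A] and let the digits of [k] mark the larger items absent from [A]. Hence
    each coordinate of a state is counted by some [orders_from], so zero potential leaves only the
    empty state. *)
Lemma ordered_set_surj m (A : neset m) :
  exists i : 'I_m, exists2 k, k < 2 ^ (m - i.+1) & ordered_neset i k = A.
Proof.
have /set0Pn[i0 i0A] := valP A.
case: (arg_minnP (fun s : 'I_m => val s) i0A) => i iA i_min.
have [k kK digits_k] := binary_digit_ex (m - i.+1)
  (fun e => if insub (m - e.+1) is Some s then s \notin val A else false).
exists i, k => //; apply/val_inj/setP => s /=; rewrite inE.
case: (ltngtP i s) => [ltis|ltsi|/val_inj <-]; last first.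
- by rewrite eqxx; exact: esym.
- rewrite -val_eqE ltn_eqF //=; apply/esym/negP => /i_min /=; lia.
- rewrite -val_eqE gtn_eqF //= digits_k; last by have := ltn_ord s; lia.
  have -> : m - (m - s.+1).+1 = s by have := ltn_ord s; lia.
  by rewrite valK negbK.
Qed.

End BinaryDigits.

(** * Orders grouped by least item, and the potential of a set of states *)

Section OrdersByLeastItem.
Local Open Scope nat_scope.
Variables (m : nat) (C : 'I_m -> nat).
Implicit Types (n : state C) (i : 'I_m) (U : {set state C}).

(* As k runs over its range, A^i_k runs once over the sets with least element
   i, so this counts the orders whose least item is i. *)
Definition orders_from n i : nat := prefix_count n i (2 ^ (m - i.+1)).

Lemma ordered_neset_inj i :
  injective (fun l : 'I_(2 ^ (m - i.+1)) => ordered_neset i l).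
Proof.
move=> k l /(congr1 val) /= /ordered_set_inj eq_kl.
by apply/val_inj/eq_kl.
Qed.

(** The sets enumerated for [i] are distinct and all contain [i], so the count is a subsum of
    [psi n i]. *)
Lemma orders_from_le_capacity n i : orders_from n i <= C i.
Proof.
apply: leq_trans (forallP (counts_admissible n) i).
rewrite /orders_from /prefix_count /psi.
have <- := @big_imset _ _ addn _ _ _ predT (fun A => n A)
  (in2W (@ordered_neset_inj i)).
rewrite big_mkcond [leqRHS]big_mkcond /=; apply: leq_sum => A _.
by case: imsetP => // -[l _ ->] /=; rewrite inE eqxx.
Qed.

(** At most one enumerated set equals [available n A], by injectivity; if one does, then [i] lies in
    it, hence in [A]. *)
Lemma orders_from_arrive n A i :
  orders_from (arrive n A) i <= orders_from n i + (i \in A).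
Proof.
rewrite /orders_from /prefix_count.
under eq_bigr do rewrite ffunE.
rewrite big_split leq_add2l /=.
under eq_bigr do rewrite ffunE /=.
case: (pickP (fun l : 'I_(2 ^ (m - i.+1)) => ordered_set i l == available n A)).
  move=> l /eqP eq_l; rewrite (bigD1 l) //= big1 => [|k /negPf neq_kl].
    have : i \in available n A by rewrite -eq_l inE eqxx.
    by rewrite inE => /andP[-> _]; case: eqP.
  case: eqP => // eq_k; case/eqP: neq_kl.
  by apply: ordered_neset_inj; apply: val_inj; rewrite /= eq_k.
by move=> no_l; rewrite big1 // => l _; rewrite no_l.
Qed.

Lemma orders_from_depart n A i : orders_from (depart n A) i <= orders_from n i.
Proof. by apply: leq_sum => l _; rewrite ffunE leq_subr. Qed.

Lemma orders_from_serve n i j i' :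
  orders_from (serve n i j) i' <= orders_from n i'.
Proof. by rewrite /serve; case: ifP => // _; exact: orders_from_depart. Qed.

Lemma orders_from_depart_lt n i k : k < 2 ^ (m - i.+1) ->
  0 < n (ordered_neset i k) ->
  orders_from (depart n (ordered_set i k)) i < orders_from n i.
Proof.
move=> kK n_gt0; rewrite /orders_from /prefix_count.
rewrite (bigD1 (Ordinal kK)) //= [ltnRHS](bigD1 (Ordinal kK)) //=.
rewrite -addSn leq_add //.
  by rewrite !ffunE /= eqxx subn1 prednK.
by apply: leq_sum => l _; rewrite ffunE leq_subr.
Qed.

(** Discrete intermediate values: the prefix counts start at 0 and end above [j]. This keeps the
    [find] of [serve] within range. *)
Lemma prefix_count_crossing n i j K : j < prefix_count n i K ->
  has (fun k => prefix_count n i k < j.+1 <= prefix_count n i k.+1) (iota 0 K).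
Proof.
elim: K => [|K IH]; first by rewrite /prefix_count big_ord0.
move=> jK; rewrite -[K.+1]addn1 iotaD has_cat /= orbF add0n ltnS jK andbT.
by case: ltnP => [/IH ->|_]; rewrite ?orbT.
Qed.

Lemma orders_from_serve_lt n i j : j < orders_from n i ->
  orders_from (serve n i j.+1) i < orders_from n i.
Proof.
move=> jn; rewrite /serve -/(orders_from n i) [_ < j.+1]ltnNge jn /=.
have found := prefix_count_crossing jn.
set p := (fun k => _) in found *.
have kK : find p (iota 0 (2 ^ (m - i.+1))) < 2 ^ (m - i.+1).
  by rewrite -[X in _ < X](size_iota 0) -has_find.
apply: orders_from_depart_lt => //.
(* The prefix count strictly increases at the index found, so the coordinate to be decremented is
   positive. *)
have := nth_find 0 found; rewrite nth_iota // add0n /p => /andP[lo hi].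
have := leq_trans lo hi.
by rewrite /prefix_count big_ord_recr /= -[X in X < _ -> _]addn0 ltn_add2l.
Qed.

Definition max_orders U i : nat := \max_(n in U) orders_from n i.

Definition potential U : nat := \sum_i max_orders U i.

Lemma max_orders_le_capacity U i : max_orders U i <= C i.
Proof. by apply/bigmax_leqP => n _; exact: orders_from_le_capacity. Qed.

Lemma orders_from_le_max U n i : n \in U -> orders_from n i <= max_orders U i.
Proof. by move=> nU; exact: (bigmax_sup n). Qed.

Lemma max_orders_arrival U (A : neset m) i :
  max_orders (g_image U [:: Arrival C A]) i <= max_orders U i + (i \in val A).
Proof.
apply/bigmax_leqP => _ /imsetP[n nU ->].
rewrite (leq_trans (orders_from_arrive _ _ _)) // leq_add2r.
exact: orders_from_le_max.
Qed.

(** Suppose [j < max_orders U i]. States with more than [j] orders from [i] lose one, and the others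
    are already strictly below the maximum. *)
Lemma max_orders_service U i (j : 'I_(C i)) i' :
  max_orders (g_image U [:: Service j]) i' <=
    max_orders U i' - ((i' == i) && (j < max_orders U i)).
Proof.
apply/bigmax_leqP => _ /imsetP[n nU ->] /=.
have le_max k : orders_from n k <= max_orders U k by exact: orders_from_le_max.
have le_n := orders_from_serve n i j.+1 i'.
have [eq_i|_] := eqVneq i' i; last first.
  by rewrite subn0 (leq_trans le_n).
subst i'; rewrite /=; case: (ltnP j (orders_from n i)) => [jn|nj].
  have := orders_from_serve_lt jn; have := le_max i.
  by case: (j < max_orders U i) => /=; lia.
have := le_max i; lia.
Qed.

Lemma g_image_cons U e w : g_image U (e :: w) = g_image (g_image U [:: e]) w.
Proof.
apply/setP => n; apply/imsetP/imsetP => [[n1 n1U ->]|[_ /imsetP[n1 n1U ->] ->]].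
  by exists (g n1 e) => //; apply/imsetP; exists n1.
by exists n1.
Qed.

Lemma g_image_nil U : g_image U [::] = U.
Proof. by rewrite /g_image imset_id. Qed.

Lemma g_image_neq0 U w : U != set0 -> g_image U w != set0.
Proof. by rewrite /g_image imset_eq0. Qed.

Lemma card_g_image1 U w : #|U| == 1 -> #|g_image U w| == 1.
Proof. by case/cards1P => n ->; rewrite /g_image imset_set1 cards1. Qed.

Lemma potential_gt0 U : U != set0 -> #|U| != 1 -> 0 < potential U.
Proof.
move=> U0; apply: contraR; rewrite -eqn0Ngt sum_nat_eq0 => /forallP max0.
rewrite eqn_leq card_gt0 U0 andbT.
apply/card_le1_eqP => n1 n2 n1U n2U.
suff zero n : n \in U -> forall A, n A = 0.
  by apply/val_inj/ffunP => A; rewrite /= !zero.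
move=> nU A; have [i [k kK <-]] := ordered_set_surj A.
have : orders_from n i <= 0.
  by rewrite (leq_trans _ (eq_leq (eqP (max0 i)))) // orders_from_le_max.
rewrite leqn0 /orders_from /prefix_count sum_nat_eq0.
by move=> /forallP/(_ (Ordinal kK))/eqP.
Qed.

End OrdersByLeastItem.

From mathcomp Require Import all_classical all_reals all_analysis.
From mathcomp Require Import measurable_realfun.

Import Order.TTheory GRing.Theory Num.Theory.

(** * Events as a finite type, with sums split into arrivals and services *)

Section EventFinite.
Variables (m : nat) (C : 'I_m -> nat).

Definition event_code (e : event C) : neset m + {i : 'I_m & 'I_(C i)} :=
  match e with
  | Arrival A => inl A
  | Service i j => inr (Tagged _ j)
  end.

Definition event_decode (x : neset m + {i : 'I_m & 'I_(C i)}) : event C :=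
  match x with
  | inl A => Arrival C A
  | inr y => Service (tagged y)
  end.

Lemma event_codeK : cancel event_code event_decode. Proof. by case. Qed.

Lemma event_decodeK : cancel event_decode event_code.
Proof. by case=> // -[]. Qed.

HB.instance Definition _ := Finite.copy (event C) (can_type event_codeK).

Lemma sum_event (V : nmodType) (F : event C -> V) :
  (\sum_e F e =
   \sum_(A : neset m) F (Arrival C A) + \sum_i \sum_(j < C i) F (Service j))%R.
Proof.
rewrite (reindex event_decode) /=; last first.
  exists event_code => x _; [exact: event_decodeK | exact: event_codeK].
rewrite big_sumType /=; congr (_ + _)%R.
by rewrite sig_big_dep /=; apply: eq_bigr => -[].
Qed.

End EventFinite.

(** * Change of the potential under one event *)

Section PotentialStep.
Local Open Scope nat_scope.
Variables (m : nat) (C : 'I_m -> nat) (U : {set state C}).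

Lemma potential_arrival (A : neset m) :
  potential (g_image U [:: Arrival C A]) <= potential U + \sum_i (i \in val A).
Proof.
rewrite /potential -big_split /=; apply: leq_sum => i _.
exact: max_orders_arrival.
Qed.

Lemma potential_service i (j : 'I_(C i)) :
  potential (g_image U [:: Service j]) + (j < max_orders U i) <= potential U.
Proof.
rewrite /potential (bigD1 i) //= [leqRHS](bigD1 i) //= addnAC leq_add //.
  have := max_orders_service U j i; rewrite eqxx /=.
  by case: ltnP => /=; lia.
apply: leq_sum => i' ne_i; have := max_orders_service U j i'.
by rewrite (negPf ne_i) subn0.
Qed.

Lemma sum_ltn_ord n k : \sum_(j < n) (j < k) = minn n k.
Proof.
elim: n => [|n IH]; first by rewrite big_ord0 min0n.
by rewrite big_ord_recr /= IH; case: ltnP; lia.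
Qed.

(** Since [max_orders U i] never exceeds [C i], exactly that many of the services at [i] are
    effective. *)
Lemma sum_busy_services :
  \sum_i \sum_(j < C i) (j < max_orders U i) = potential U.
Proof.
apply: eq_bigr => i _; rewrite sum_ltn_ord; apply/minn_idPr.
exact: max_orders_le_capacity.
Qed.

End PotentialStep.

(** * Mass of a set of words with independent letters *)

Section WordMass.
Local Open Scope ring_scope.
Variables (R : realType) (E : finType) (p : E -> R).

(** The product measure of the words of length [t] satisfying [B], in a recursive form suited to
    first-letter analysis. *)
Fixpoint word_mass t (B : pred (seq E)) : R :=
  if t is s.+1 then \sum_e p e * word_mass s (fun w => B (e :: w))
  else (B [::])%:R.

Lemma eq_word_mass t B1 B2 :
  B1 =1 B2 -> word_mass t B1 = word_mass t B2.
Proof.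
elim: t B1 B2 => [|t IH] B1 B2 eqB /=; first by rewrite eqB.
by apply: eq_bigr => e _; congr (_ * _); apply: IH.
Qed.

Lemma word_mass0 t : word_mass t pred0 = 0.
Proof. by elim: t => //= t IH; rewrite big1 // => e _; rewrite IH mulr0. Qed.

End WordMass.

(** * Drift of the potential and summation of the non-coupling probabilities *)

Section Drift.
Local Open Scope ring_scope.
Variables (R : realType) (m : nat) (C : 'I_m -> nat).
Variables (mu : R) (lam : neset m -> R).
Hypotheses (mu_gt0 : 0 < mu) (lam_ge0 : forall A, 0 <= lam A).
Hypotheses (m_gt0 : (0 < m)%N) (C_gt0 : forall i, (0 < C i)%N).
Notation nu := (@nu R m C mu lam).
Notation Lambda := (Lambda C mu lam).

Lemma Lambda_gt0 : 0 < Lambda.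
Proof.
rewrite /Defs.Lambda ltr_wpDl //; first exact: sumr_ge0.
rewrite mulr_gt0 // ltr0n /total_capacity (bigD1 (Ordinal m_gt0)) //=.
by rewrite addn_gt0 C_gt0.
Qed.

Lemma nu_ge0 e : 0 <= nu e.
Proof. by case: e => [A|i j]; rewrite divr_ge0 // ltW // Lambda_gt0. Qed.

Lemma sum_nu : \sum_e nu e = 1.
Proof.
rewrite sum_event /= -mulr_suml.
under [X in _ + X]eq_bigr do rewrite sumr_const card_ord.
rewrite sumrMnr -/(total_capacity C) -mulr_natr mulrAC -mulrDl.
by rewrite divff // gt_eqF // Lambda_gt0.
Qed.

Lemma sum_lam_card :
  \sum_(A : neset m) lam A * (\sum_i (i \in val A))%:R =
  \sum_i lam_item lam i.
Proof.
under eq_bigr do rewrite natr_sum mulr_sumr.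
rewrite exchange_big /=; apply: eq_bigr => i _.
rewrite /lam_item [RHS]big_mkcond /=; apply: eq_bigr => A _.
by case: (i \in _); rewrite ?mulr1 ?mulr0.
Qed.

Lemma potential_drift (U : {set state C}) :
  \sum_e nu e * (potential (g_image U [:: e]))%:R <=
  (potential U)%:R
    + (\sum_i lam_item lam i - mu * (potential U)%:R) / Lambda.
Proof.
rewrite sum_event /=.
have arrivals : \sum_(A : neset m)
    lam A / Lambda * (potential (g_image U [:: Arrival C A]))%:R <=
    \sum_(A : neset m) (lam A / Lambda * (potential U)%:R
      + lam A * (\sum_i (i \in val A))%:R / Lambda).
  apply: ler_sum => A _; rewrite [X in _ + X]mulrAC -mulrDr -natrD.
  apply: ler_wpM2l; first exact: (nu_ge0 (Arrival C A)).
  by rewrite ler_nat potential_arrival.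
have services : \sum_i \sum_(j < C i)
    mu / Lambda * (potential (g_image U [:: Service j]))%:R <=
    \sum_i \sum_(j < C i) (mu / Lambda * (potential U)%:R
      - mu / Lambda * (j < max_orders U i)%:R).
  apply: ler_sum => i _; apply: ler_sum => j _; rewrite -mulrBr.
  apply: ler_wpM2l; first exact: (nu_ge0 (Service j)).
  by rewrite lerBrDr -natrD ler_nat potential_service.
apply: le_trans (lerD arrivals services) _.
rewrite big_split /= -[X in _ + X + _]mulr_suml sum_lam_card.
under [X in _ + X]eq_bigr do rewrite big_split /= sumrN.
rewrite big_split /= sumrN.
have -> : \sum_i \sum_(j < C i) mu / Lambda * (j < max_orders U i)%:R =
    mu / Lambda * (potential U)%:R.
  rewrite -sum_busy_services natr_sum mulr_sumr; apply: eq_bigr => i _.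
  by rewrite natr_sum mulr_sumr.
(* The event probabilities sum to 1, so the unchanged parts of the potential recombine. *)
have total : \sum_(A : neset m) lam A / Lambda * (potential U)%:R +
    \sum_i \sum_(j < C i) mu / Lambda * (potential U)%:R = (potential U)%:R.
  rewrite -[RHS]mul1r -sum_nu sum_event /= mulrDl !mulr_suml.
  by under [X in _ = _ + X]eq_bigr do rewrite mulr_suml.
rewrite -[X in _ <= X + _]total le_eqVlt; apply/orP; left; apply/eqP; ring.
Qed.

(** Induction on [t] for all [U], conditioning on the first letter. A singleton stays a singleton,
    so its sum vanishes; otherwise the term [s = 0] costs [del], which the drift pays for. *)
Lemma sum_word_mass_le (U : {set state C}) t : U != finset.set0 ->
  \sum_i lam_item lam i < mu ->
  (mu - \sum_i lam_item lam i) / Lambda *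
    \sum_(s < t) word_mass nu s (fun w => #|g_image U w| != 1%N)
  <= (potential U)%:R.
Proof.
move=> U0 stable; set del := (_ / _).
elim: t U U0 => [|t IH] U U0; first by rewrite big_ord0 mulr0.
have [U1|U1] := boolP (#|U| == 1%N).
  rewrite [X in _ * X]big1 ?mulr0 // => s _; rewrite -(word_mass0 nu s).
  by apply: eq_word_mass => w; rewrite /= card_g_image1.
have mass_recl s : word_mass nu s.+1 (fun w => #|g_image U w| != 1%N) =
    \sum_e nu e * word_mass nu s
      (fun w => #|g_image (g_image U [:: e]) w| != 1%N).
  apply: eq_bigr => e _; congr (_ * _).
  by apply: eq_word_mass => w; rewrite g_image_cons.
rewrite big_ord_recl.
under [X in _ * (_ + X)]eq_bigr do rewrite lift0 mass_recl.
rewrite /= g_image_nil U1 exchange_big /= mulrDr mulr1 mulr_sumr.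
have step : \sum_e del *
    (\sum_(s < t) nu e * word_mass nu s
      (fun w => #|g_image (g_image U [:: e]) w| != 1%N)) <=
    \sum_e nu e * (potential (g_image U [:: e]))%:R.
  apply: ler_sum => e _; rewrite -mulr_sumr mulrCA ler_wpM2l ?nu_ge0 //.
  by apply: IH; exact: g_image_neq0.
(* A potential of at least 1 makes the service rate at least [mu], hence the drift at most
   [- del]. *)
have pot_ge1 : 1 <= (potential U)%:R :> R by rewrite ler1n potential_gt0.
rewrite -lerBrDl (le_trans step) // (le_trans (potential_drift U)) //.
rewrite lerD2l /del -[leRHS]mulNr opprB.
rewrite ler_wpM2r ?invr_ge0 ?(ltW Lambda_gt0) //.
by rewrite lerD2l lerN2 ler_peMr // ltW.
Qed.

End Drift.

(** * Law of the reversed words read from the event sequence *)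

Section ReversedWords.
Local Open Scope classical_set_scope.
Local Open Scope ring_scope.
Variables (R : realType) (d : measure_display) (T : measurableType d).
Variables (P : probability T R) (E : finType) (p : E -> R) (a : nat -> T -> E).
Hypothesis a_iid : iid_with_law P p a.

Definition window w s k : seq E := [seq a r w | r <- iota s k].

Definition reversed_then t (B : pred (seq E)) (u : seq E) : set T :=
  [set w | B (rev (window w 0 t)) /\ window w t (size u) = u].

Lemma rev_windowS w t :
  rev (window w 0 t.+1) = a t w :: rev (window w 0 t).
Proof. by rewrite /window -[t.+1]addn1 iotaD map_cat rev_cat. Qed.

Lemma measure_window (u : seq E) :
  measurable [set w | window w 0 (size u) = u] /\
  P [set w | window w 0 (size u) = u] = (\prod_(e <- u) p e)%:E.
Proof.
have [a_meas a_law a_indep] := a_iid.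
(* The empty word is treated apart: a nonempty one supplies the default letter [e0] for [nth]. *)
case: u => [|e0 u'].
  rewrite (_ : [set _ | _] = setT); first by rewrite big_nil probability_setT.
  by apply/seteqP.
move: (e0 :: u') => u.
have -> : [set w | window w 0 (size u) = u] =
    \bigcap_(s in [set` iota 0 (size u)]) (a s @^-1` [set nth e0 u s]).
  apply/seteqP; split => w /=.
    move=> <- s /=; rewrite mem_iota add0n size_map size_iota => /andP[_ su].
    by rewrite (nth_map 0%N) ?size_iota // nth_iota.
  move=> all_eq; apply: (@eq_from_nth _ e0).
    by rewrite size_map size_iota.
  move=> s; rewrite size_map size_iota => su.
  rewrite (nth_map 0%N) ?size_iota // nth_iota // add0n.
  by apply: all_eq; rewrite /= mem_iota.
split; first by apply: fin_bigcap_measurable => // s _; exact: a_meas.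
rewrite (a_indep _ (fun s => [set nth e0 u s])) ?iota_uniq //.
rewrite (eq_bigr (fun s => (p (nth e0 u s))%:E)); last first.
  by move=> s _; exact: a_law.
by rewrite prodEFin [in RHS](big_nth e0) /index_iota subn0.
Qed.

(* The letter a_t heads the word a_t ... a_0, so conditioning on it peels off
   the first letter as in [word_mass]; the exact window u after time t keeps
   track of the letters already peeled. *)
Lemma measure_reversed_then t (B : pred (seq E)) (u : seq E) :
  measurable (reversed_then t B u) /\
  P (reversed_then t B u) = (word_mass p t B * \prod_(e <- u) p e)%:E.
Proof.
elim: t B u => [|t IH] B u.
  rewrite /reversed_then /=; case: (B [::]); last first.
    rewrite (_ : [set _ | _] = set0) ?measure0 ?mul0r //.
    by apply/seteqP; split => // w /= [].
  rewrite mul1r (_ : [set _ | _] = [set w | window w 0 (size u) = u]).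
    exact: measure_window.
  by apply/seteqP; split => w //= [].
pose F e := reversed_then t (fun w => B (e :: w)) (e :: u).
have FE : reversed_then t.+1 B u = \bigcup_(e in [set` index_enum E]) F e.
  apply/seteqP; split => w; rewrite /F /reversed_then.
    move=> [+ u_eq]; rewrite rev_windowS => Bw.
    exists (a t w) => /=; first by rewrite mem_index_enum.
    by split; rewrite //= -[in RHS]u_eq.
  by move=> [e _ [Be [e_eq u_eq]]]; split; rewrite ?rev_windowS ?e_eq.
have mF e : measurable (F e) by have [] := IH (fun w => B (e :: w)) (e :: u).
rewrite FE; split; first exact: fin_bigcup_measurable.
rewrite measure_fin_bigcup //; last first.
  move=> e1 e2 _ _ [w []]; rewrite /F /reversed_then /= => -[_ [<- _]].
  by move=> [_ [<- _]].
rewrite -fsbig_seq ?index_enum_uniq //= mulr_suml -sumEFin.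
apply: eq_bigr => e _; have [_ ->] := IH (fun w => B (e :: w)) (e :: u).
by rewrite big_cons mulrCA mulrA.
Qed.

Lemma measure_reversed t (B : pred (seq E)) :
  measurable [set w | B (rev (window w 0 t))] /\
  P [set w | B (rev (window w 0 t))] = (word_mass p t B)%:E.
Proof.
have := measure_reversed_then t B [::]; rewrite big_nil mulr1.
rewrite (_ : reversed_then t B [::] = [set w | B (rev (window w 0 t))]) //.
by apply/seteqP; split => w // -[].
Qed.

End ReversedWords.

(** * Expected hitting times bounded by tail sums *)

Section Hitting.
Local Open Scope classical_set_scope.
Local Open Scope ring_scope.
Local Open Scope ereal_scope.

(* Unlike [ge0_le_integral], no measurability is required: the integral of a
   nonnegative function is a supremum over the simple functions below it. *)
Lemma ge0_le_integralT d (T : measurableType d) (R : realType)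
    (mu : {measure set T -> \bar R}) (f1 f2 : T -> \bar R) :
  (forall x, 0 <= f1 x) -> (forall x, f1 x <= f2 x) ->
  \int[mu]_x f1 x <= \int[mu]_x f2 x.
Proof.
move=> f1_ge0 f12; rewrite !ge0_integralE //; last first.
  by move=> x _; exact: le_trans (f12 x).
rewrite !patch_setT; apply: ereal_sup_le => _ [h h_le <-].
by exists h => // x; exact: le_trans (f12 x).
Qed.

(** All terms before the first hit equal 1, so the series is at least the hitting time; without a
    hit its partial sums are unbounded. *)
Lemma ereal_inf_hitting_le (R : realType) (Q : pred nat) :
  ereal_inf [set t%:R%:E | t in [set t : nat | Q t]] <=
  \sum_(t <oo) (~~ Q t)%:R%:E :> \bar R.
Proof.
have ge_card k : (forall t, (t < k)%N -> ~~ Q t) ->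
    k%:R%:E <= \sum_(t <oo) (~~ Q t)%:R%:E :> \bar R.
  move=> notQ; apply: le_trans (nneseries_lim_ge k _); last first.
    by move=> t _ _; rewrite lee_fin ler0n.
  rewrite big_mkord sumEFin lee_fin (eq_bigr (fun=> 1%R)).
    by rewrite sumr_const card_ord.
  by move=> t _; rewrite notQ.
have [[t Qt]|noQ] := pselect (exists t, Q t).
  have exQ : exists t, Q t by exists t.
  case: (ex_minnP exQ) => s Qs s_min.
  apply: (@le_trans _ _ s%:R%:E); first by apply: ereal_inf_lbound; exists s.
  apply: ge_card => r; rewrite ltnNge; apply: contra; exact: s_min.
rewrite (_ : \sum_(_ <oo) _ = +oo) ?leey //.
apply/eqyP => x x_gt0; apply: le_trans (ge_card (Num.truncn x).+1 _).
  by rewrite lee_fin ltW // truncnS_gt.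
by move=> t _; apply/negP => Qt; apply: noQ; exists t.
Qed.

Lemma integral_hitting_le d (T : measurableType d) (R : realType)
    (P : probability T R) (Q : nat -> pred T) (M : \bar R) :
  (forall t, measurable [set w | ~~ Q t w]) ->
  (forall k, \sum_(t < k) P [set w | ~~ Q t w] <= M) ->
  \int[P]_w ereal_inf [set t%:R%:E | t in [set t : nat | Q t w]] <= M.
Proof.
move=> mQ sum_le.
apply: (@le_trans _ _ (\int[P]_w \sum_(t <oo) (\1_[set w | ~~ Q t w] w)%:E)).
  apply: ge0_le_integralT => w.
    by apply: le_ereal_inf_tmp => _ [t _ <-]; rewrite lee_fin ler0n.
  apply: le_trans (ereal_inf_hitting_le R (Q ^~ w)) _.
  apply: lee_nneseries => [t _ _|t _]; first by rewrite lee_fin ler0n.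
  rewrite indicE; case: (boolP (Q t w)) => Qt; rewrite lee_fin ?ler0n //.
  by rewrite mem_set.
rewrite integral_nneseries //; last first.
  by move=> t; apply/measurable_EFinP; exact: measurable_indic.
apply: lime_le; first by apply: is_cvg_nneseries => t _ _; exact: integral_ge0.
apply: nearW => k; rewrite big_mkord.
under eq_bigr do rewrite integral_indic // setIT.
exact: sum_le.
Qed.

End Hitting.

(** * Bound on the expected coupling time *)

Local Open Scope ring_scope.

Theorem theorem23 (R : realType) (m : nat) (C : 'I_m -> nat)
    (mu : R) (lam : neset m -> R)
    (d : measure_display) (T : measurableType d) (P : probability T R)
    (a : nat -> T -> event C)
    (hm : (1 <= m)%N)
    (hC : forall i, (0 < C i)%N)
    (hmu : 0 < mu)
    (hlam : forall A, 0 <= lam A)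
    (ha : iid_with_law P (nu mu lam) a)
    (hstab : \sum_(i < m) lam_item lam i < mu) :
  (\int[P]_w coupling_time R a w <=
    (Lambda C mu lam / (mu - \sum_(i < m) lam_item lam i)
      * (total_capacity C)%:R)%:E)%E.
Proof.
(* [past_word] unfolds to the reversed window, so these are the events of not having coupled at
   [t]. *)
have uncoupled t := measure_reversed ha t
  (fun w => #|g_image [set: state C]%SET w| != 1%N).
apply: (integral_hitting_le (Q := fun t w => coupled (a ^~ w) t)) => [t|k].
  by have [] := uncoupled t.
under eq_bigr => t _ do have [_ ->] := uncoupled t.
rewrite sumEFin lee_fin.
have empty_adm : admissible C [ffun=> 0%N].
  by apply/forallP => i; rewrite /psi big1 // => A _; rewrite ffunE.
have nonempty : [set: state C]%SET != finset.set0.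
  by apply/finset.set0Pn; exists (State empty_adm); rewrite finset.inE.
have gap : 0 < mu - \sum_(i < m) lam_item lam i by rewrite subr_gt0.
have L_gt0 := Lambda_gt0 hmu hlam hm hC.
(* Multiplying by the drift gap over [Lambda] reduces the right-hand side to the total capacity,
   which bounds the potential of the full state space. *)
rewrite -(ler_pM2l (divr_gt0 gap L_gt0)).
rewrite [leRHS]mulrA [X in _ <= X * _]mulrA divfK ?gt_eqF //.
rewrite divff ?gt_eqF // mul1r.
apply: le_trans (sum_word_mass_le hmu hlam hm hC k nonempty hstab) _.
rewrite ler_nat.
by apply: leq_sum => i _; exact: max_orders_le_capacity.
Qed.
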